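(* There exist non-empty sets $S_q\subseteq\mathbb{Z}_{>0}$, for $q\in\{2,3,4,5,7,11,13,17,19\}$, such that the $3$-dimensional Fine $\mathbb{Q}$-codegree spectrum is $$S^F(3)=\left\{\frac{q}{k\cdot\ell}\;\middle|\; q\in\{2,3,4,5,7,11,13,17,19\},\ \ell\in S_q,\ k\in\mathbb{Z}_{>0}\right\}.$$
   Context: For a $d$-dimensional rational polytope $P\subseteq\mathbb{R}^d$ and $a\in(\mathbb{Z}^d)^*$ let $h_P(a)=\min_{x\in P}\langle a,x\rangle$. For $s>0$ the Fine adjoint polytope is $P^{F(s)}=\{x\in\mathbb{R}^d : \langle a,x\rangle\ge h_P(a)+s \text{ for all } a\in(\mathbb{Z}^d)^*\setminus\{0\}\}$. The Fine $\mathbb{Q}$-codegree is $\mu^F(P)=(\sup\{s>0 : P^{F(s)}\neq\emptyset\})^{-1}$. The Fine spectrum in dimension $d$ is $S^F(d)=\{\mu^F(P) : P \text{ a } d\text{-dimensional lattice polytope}\}$, lattice polytopes being those with vertices in $\mathbb{Z}^d$. *)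

(* Defs.v *)
From HB Require Import structures.
From mathcomp Require Import all_boot all_order all_algebra.
From mathcomp Require Import boolp classical_sets reals.
Set Implicit Arguments. Unset Strict Implicit. Unset Printing Implicit Defensive.
Import Order.TTheory GRing.Theory Num.Theory.
Local Open Scope ring_scope.
Local Open Scope classical_set_scope.

Section Fine.
Variable R : realType.

Definition pair_ix (d : nat) (a : 'I_d -> int) (x : 'I_d -> R) : R :=
  \sum_(i < d) (a i)%:~R * x i.

Definition latpt (d : nat) (v : 'I_d -> int) : 'I_d -> R := fun j => (v j)%:~R.

Definition conv_lat (d n : nat) (V : 'I_n -> 'I_d -> int) : set ('I_d -> R) :=
  [set x | exists w : 'I_n -> R,
     (forall i, 0 <= w i) /\ \sum_(i < n) w i = 1 /\
     forall j, x j = \sum_(i < n) w i * latpt (V i) j].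

Definition full_dim (d n : nat) (V : 'I_n -> 'I_d -> int) : Prop :=
  forall x : 'I_d -> R, exists c : 'I_n -> R,
     \sum_(i < n) c i = 1 /\ forall j, x j = \sum_(i < n) c i * latpt (V i) j.

(* h_P(a) = min_{x in P} <a, x> (written as an infimum; attained since P compact) *)
Definition hP (d : nat) (P : set ('I_d -> R)) (a : 'I_d -> int) : R :=
  inf [set pair_ix a x | x in P].

Definition fine_adjoint (d : nat) (P : set ('I_d -> R)) (s : R) : set ('I_d -> R) :=
  [set x | forall a : 'I_d -> int, a != (fun _ => 0) ->
             pair_ix a x >= hP P a + s].

Definition fine_codegree (d : nat) (P : set ('I_d -> R)) : R :=
  (sup [set s : R | 0 < s /\ fine_adjoint P s !=set0])^-1.

Definition fine_spectrum (d : nat) : set R :=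
  [set mu | exists (n : nat) (V : 'I_n -> 'I_d -> int),
      full_dim V /\ mu = fine_codegree (conv_lat V)].

End Fine.

Definition fine_primes : seq nat := [:: 2; 3; 4; 5; 7; 11; 13; 17; 19]%N.

(* Main.v *)
Require Import Defs.
From Stdlib Require Import ZArith Lia.
From HB Require Import structures.
From mathcomp Require Import all_boot all_order all_algebra.
From mathcomp Require Import boolp classical_sets reals.
From mathcomp Require Import zify ring lra.
Import Order.TTheory GRing.Theory Num.Theory.
Local Open Scope ring_scope.
Local Open Scope classical_set_scope.

(**
  Let s be the largest number with nonempty P^{F(s)}, so that the codegree is
  1/s.  By Dickson's lemma finitely many normals cut out every P^{F(t)}, and
  Fourier-Motzkin elimination of the point yields x in P^{F(s)} together with a
  relation sum_i lam_i a_i = 0, lam_i natural numbers, between normals that are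
  active at x, i.e. <a_i, x> = h_P(a_i) + s; by Caratheodory four of them
  suffice.  With N = sum_i lam_i, this gives N s = - sum_i lam_i h_P(a_i), an
  integer.

  Lattice points in the convex hull of active normals are 0 or active, since h_P
  is superadditive.  Hence, if N is minimal, the a_i span a simplex behaving like
  a terminal one: sum_i (j lam_i mod N) >= 2N for 2 <= j < N, as otherwise the
  lattice point - sum_i floor(j lam_i / N) a_i gives a relation of smaller total
  weight.  Replacing j by N - j turns this into sum_i floor(j lam_i / N) = j - 2
  for 2 <= j <= N - 2, so passing from j to j + 1 exactly one of the four floors
  increases.  Tracking the resulting intervals for the lam_i / N shows that no
  such weights survive up to j = 18, whence N <= 19, and the remaining N are
  checked directly.  Dilating P by k divides the codegree by k, which gives the
  product structure of the spectrum.
*)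

(** * Branch-and-bound search over intervals for four weights *)

Section BoxSearch.
Local Open Scope Z_scope.

#[local] Arguments Z.mul : simpl never.
#[local] Arguments Z.add : simpl never.

(* lcm(1, ..., 18), so that every bound (f + 1) / j below is an integer after scaling *)
Definition scale : Z := 12252240.

(* [(f, lo, hi)] at step [j] records floor(j x / n) = f and lo <= scale * x / n < hi. *)
Definition box : Type := Z * Z * Z.

Definition box_in (n j x : Z) (b : box) : Prop :=
  [/\ b.1.1 * n <= j * x, j * x < (b.1.1 + 1) * n,
      b.1.2 * n <= scale * x & scale * x < b.2 * n].

(** At step [j] the floor rises exactly when x / n >= (f + 1) / j. The scaled threshold then
    sharpens the lower bound, and otherwise the upper one. *)
Definition box_up (j : Z) (b : box) : box :=
  (b.1.1 + 1, Z.max b.1.2 (scale / j * (b.1.1 + 1)), b.2).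

Definition box_stay (j : Z) (b : box) : box :=
  (b.1.1, b.1.2, Z.min b.2 (scale / j * (b.1.1 + 1))).

(** A branch closes when the weights, scaled to sum to [scale], cannot fit: lower bounds too large,
    strict upper bounds too small, or an empty interval. Otherwise it splits according to which
    floor rises. Testing that j' divides [scale] here lets the soundness proof divide exactly. *)
Fixpoint boxes_dead (k : nat) (j : Z) (b1 b2 b3 b4 : box) : bool :=
  if (scale <? b1.1.2 + b2.1.2 + b3.1.2 + b4.1.2)
     || (b1.2 + b2.2 + b3.2 + b4.2 <=? scale)
     || [|| b1.2 <=? b1.1.2, b2.2 <=? b2.1.2, b3.2 <=? b3.1.2 | b4.2 <=? b4.1.2]
  then true
  else if k is S k' then
    let j' := j + 1 in
    let u := box_up j' in let s := box_stay j' in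
    [&& (scale mod j' =? 0), boxes_dead k' j' (u b1) (s b2) (s b3) (s b4),
        boxes_dead k' j' (s b1) (u b2) (s b3) (s b4),
        boxes_dead k' j' (s b1) (s b2) (u b3) (s b4)
      & boxes_dead k' j' (s b1) (s b2) (s b3) (u b4)]
  else false.

(** As 0 <= x < n, passing from [j] to [j + 1] raises the floor by 0 or 1. *)
Lemma box_in_step (n j x : Z) (b : box) :
  0 < j -> 0 < n -> 0 <= x -> x < n -> scale mod (j + 1) = 0 -> box_in n j x b ->
  (j + 1) * x / n = b.1.1 + 1 /\ box_in n (j + 1) x (box_up (j + 1) b) \/
  (j + 1) * x / n = b.1.1 /\ box_in n (j + 1) x (box_stay (j + 1) b).
Proof.
case: b => -[f lo] hi /= j0 n0 x0 xn /Z.div_exact dv [/= h1 h2 h3 h4].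
have {}dv : scale = (j + 1) * (scale / (j + 1)) by apply: dv; lia.
have c0 : 0 <= scale / (j + 1) by apply: Z.div_pos; rewrite ?/scale; lia.
rewrite /box_up /box_stay /box_in /=; set c := scale / (j + 1) in dv c0 *.
have [h|h] := Z.le_gt_cases ((f + 1) * n) ((j + 1) * x); [left | right]; split.
- by symmetry; apply: (Z.div_unique_pos _ _ _ ((j + 1) * x - n * (f + 1))); lia.
- split; [lia | lia | | lia].
  have : c * ((f + 1) * n) <= c * ((j + 1) * x) by apply: Z.mul_le_mono_nonneg_l.
  have -> : c * ((j + 1) * x) = scale * x by rewrite [in RHS]dv; ring.
  by case: (Z.max_spec lo (c * (f + 1))) => -[_ ->]; lia.
- by symmetry; apply: (Z.div_unique_pos _ _ _ ((j + 1) * x - n * f)); lia.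
- split; [lia | lia | lia | ].
  have cp : 0 < c by have : scale = 12252240 by []; nia.
  have : c * ((j + 1) * x) < c * ((f + 1) * n) by apply: Zmult_lt_compat_l.
  have -> : c * ((j + 1) * x) = scale * x by rewrite [in RHS]dv; ring.
  by case: (Z.min_spec hi (c * (f + 1))) => -[_ ->]; lia.
Qed.

Lemma boxes_deadP (n x1 x2 x3 x4 : Z) (k : nat) (j : Z) (b1 b2 b3 b4 : box) :
  0 < j -> 0 < n -> [/\ 0 <= x1, 0 <= x2, 0 <= x3 & 0 <= x4] ->
  [/\ x1 < n, x2 < n, x3 < n & x4 < n] -> x1 + x2 + x3 + x4 = n ->
  boxes_dead k j b1 b2 b3 b4 ->
  [/\ box_in n j x1 b1, box_in n j x2 b2, box_in n j x3 b3 & box_in n j x4 b4] ->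
  b1.1.1 + b2.1.1 + b3.1.1 + b4.1.1 = j - 2 ->
  (forall i, j < i <= j + Z.of_nat k ->
     i * x1 / n + i * x2 / n + i * x3 / n + i * x4 / n = i - 2) -> False.
Proof.
move=> j0 n0 [p1 p2 p3 p4] [q1 q2 q3 q4] xn.
elim: k j j0 b1 b2 b3 b4 => [|k IHk] j j0 b1 b2 b3 b4 /=.
  case: ifP => // h _ [[_ _ l1 u1] [_ _ l2 u2] [_ _ l3 u3] [_ _ l4 u4]] _ _.
  by case/orP: h => [/orP[/Z.ltb_lt h|/Z.leb_le h]|/or4P[] /Z.leb_le h]; nia.
case: ifP => [h _ [[_ _ l1 u1] [_ _ l2 u2] [_ _ l3 u3] [_ _ l4 u4]] _ _|_].
  by case/orP: h => [/orP[/Z.ltb_lt h|/Z.leb_le h]|/or4P[] /Z.leb_le h]; nia.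
case/and5P=> /Z.eqb_eq dv d1 d2 d3 d4 [i1 i2 i3 i4] sf hf.
have hj := hf (j + 1) ltac:(lia).
have hf' i : j + 1 < i <= j + 1 + Z.of_nat k ->
     i * x1 / n + i * x2 / n + i * x3 / n + i * x4 / n = i - 2.
  by move=> hi; apply: hf; lia.
have j1 : 0 < j + 1 by lia.
(* The floor sum grows by one, so of the sixteen patterns only the four with a single rise survive;
   [lia] refutes the rest. *)
case: (box_in_step _ _ _ _ j0 n0 p1 q1 dv i1) => -[e1 {}i1];
case: (box_in_step _ _ _ _ j0 n0 p2 q2 dv i2) => -[e2 {}i2];
case: (box_in_step _ _ _ _ j0 n0 p3 q3 dv i3) => -[e3 {}i3];
case: (box_in_step _ _ _ _ j0 n0 p4 q4 dv i4) => -[e4 {}i4]; try lia.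
- by apply: (IHk _ j1 _ _ _ _ d1 (And4 i1 i2 i3 i4) _ hf'); rewrite /box_up /=; lia.
- by apply: (IHk _ j1 _ _ _ _ d2 (And4 i1 i2 i3 i4) _ hf'); rewrite /box_up /=; lia.
- by apply: (IHk _ j1 _ _ _ _ d3 (And4 i1 i2 i3 i4) _ hf'); rewrite /box_up /=; lia.
- by apply: (IHk _ j1 _ _ _ _ d4 (And4 i1 i2 i3 i4) _ hf'); rewrite /box_up /=; lia.
Qed.

Definition box_half : box := (0, 0, scale / 2).

(** Sixteen steps lead from j = 2 to j = 18. *)
Lemma boxes_half_dead : boxes_dead 16 2 box_half box_half box_half box_half.
Proof. by vm_compute. Qed.

(** At i = 2 the nonnegative floors sum to 0, so each weight is below n / 2. This is the starting
    box of the search. *)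
Lemma no_floor_sums (n x1 x2 x3 x4 : Z) :
  0 < n -> [/\ 0 <= x1, 0 <= x2, 0 <= x3 & 0 <= x4] -> x1 + x2 + x3 + x4 = n ->
  (forall i, 2 <= i <= 18 ->
     i * x1 / n + i * x2 / n + i * x3 / n + i * x4 / n = i - 2) -> False.
Proof.
move=> n0 [p1 p2 p3 p4] xn hf.
have h2 := hf 2 ltac:(lia).
have small x : 0 <= x -> 0 <= 2 * x / n /\ (2 * x / n = 0 -> 2 * x < n).
  move=> x0; split; first by apply: Z.div_pos; lia.
  by move/Z.div_small_iff => /(_ ltac:(lia)); lia.
have := (small _ p1, small _ p2, small _ p3, small _ p4).
case=> -[] [] [a1 b1] [a2 b2] [a3 b3] [a4 b4].
have {}b1 := b1 ltac:(lia); have {}b2 := b2 ltac:(lia).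
have {}b3 := b3 ltac:(lia); have {}b4 := b4 ltac:(lia).
have hb x : 0 <= x -> 2 * x < n -> box_in n 2 x box_half.
  move=> x0 xlt; have e : scale = 12252240 by [].
  have e2 : scale / 2 = 6126120 by [].
  by split; rewrite /box_half /= ?e2 ?e; lia.
have lt1 : [/\ x1 < n, x2 < n, x3 < n & x4 < n] by split; lia.
have hbs := And4 (hb _ p1 b1) (hb _ p2 b2) (hb _ p3 b3) (hb _ p4 b4).
have p := And4 p1 p2 p3 p4; have z2 : 0 < 2 by [].
refine (boxes_deadP n x1 x2 x3 x4 16 2 _ _ _ _ z2 n0 p lt1 xn boxes_half_dead hbs erefl _).
by move=> i hi; apply: hf; lia.
Qed.

End BoxSearch.

(** * Totals of four weights with large residue sums *)

Section WeightSums.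
Local Open Scope nat_scope.

(* [find] and [if] rather than [has] and [||]: [vm_compute] then stops at the first failing [j]. *)
Definition residue_fails (n x1 x2 x3 x4 : nat) : bool :=
  find (fun j => (j * x1) %% n + (j * x2) %% n + (j * x3) %% n + (j * x4) %% n < 2 * n)
       (iota 2 (n - 2)) < size (iota 2 (n - 2)).

(** Exhaustive check for 2 <= n <= 19 outside [fine_primes]; the fourth weight is determined by the
    other three. *)
Lemma small_weight_sums :
  all (fun n => if n \in fine_primes then true else
    all (fun x1 => all (fun x2 => all (fun x3 =>
      if n < x1 + x2 + x3 then true else residue_fails n x1 x2 x3 (n - (x1 + x2 + x3)))
    (iota 0 n.+1)) (iota 0 n.+1)) (iota 0 n.+1)) (iota 2 18).
Proof. by vm_compute. Qed.

Lemma weight_sum_fine_primes (n x1 x2 x3 x4 : nat) :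
  2 <= n -> x1 + x2 + x3 + x4 = n ->
  (forall j, 2 <= j < n ->
     2 * n <= (j * x1) %% n + (j * x2) %% n + (j * x3) %% n + (j * x4) %% n) ->
  n \in fine_primes.
Proof.
move=> n2 xn hr; have [n20|n20] := ltnP n 20.
  have hn : n \in iota 2 18 by rewrite mem_iota; lia.
  have hx x : x <= n -> x \in iota 0 n.+1 by rewrite mem_iota; lia.
  move: {hn}(allP small_weight_sums n hn); case: ifP => // _ h.
  have {}h := allP (allP (allP h x1 (hx _ _)) x2 (hx _ _)) x3 (hx _ _).
  move: {h}(h ltac:(lia) ltac:(lia) ltac:(lia)).
  have -> /= : (n < x1 + x2 + x3) = false by lia.
  have -> : n - (x1 + x2 + x3) = x4 by lia.
  rewrite /residue_fails -has_find => /hasP[j]; rewrite mem_iota => hj.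
  by rewrite ltnNge hr //; lia.
exfalso.
(* The two residues add up to a multiple of n that is less than 2n, hence to 0 or n. *)
have compl j x : 2 <= j <= 18 -> (j * x) %% n + ((n - j) * x) %% n <= n.
  move=> hj; have n0 : 0 < n by lia.
  have e : j * x + (n - j) * x = n * x by rewrite -mulnDl; congr (_ * _); lia.
  have := divn_eq (j * x) n; have := divn_eq ((n - j) * x) n.
  have := ltn_pmod (j * x) n0; have := ltn_pmod ((n - j) * x) n0.
  move: ((j * x) %% n) ((j * x) %/ n) (((n - j) * x) %% n) (((n - j) * x) %/ n).
  move=> r q r' q' rl r'l e1 e2.
  have {e1 e2}e : r + r' + (q + q') * n = x * n by lia.
  have : (x - (q + q')) * n = r + r' by rewrite mulnBl; lia.
  by move: (x - (q + q')) => [|[|t]]; nia.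
have n0 : 0 < n by lia.
(* The sums at [j] and [n - j] are each at least 2n and together at most 4n. Here n >= 20 ensures n
   - j >= 2. *)
have sum2 j : 2 <= j <= 18 ->
    (j * x1) %% n + (j * x2) %% n + (j * x3) %% n + (j * x4) %% n = 2 * n.
  move=> hj; have hj1 : 2 <= j < n by lia.
  have hj2 : 2 <= n - j < n by lia.
  move: (hr j hj1) (hr (n - j) hj2) (compl j x1 hj) (compl j x2 hj) (compl j x3 hj) (compl j x4 hj).
  do 8! [move: (_ %% n) => ?].
  lia.
apply: (no_floor_sums (Z.of_nat n) (Z.of_nat x1) (Z.of_nat x2) (Z.of_nat x3)
                      (Z.of_nat x4)); [lia | by split; lia | lia |].
(* The products i x sum to i n; removing the residue total 2n leaves n times a floor sum equal to i
   - 2. *)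
move=> i hi; have hs := sum2 (Z.to_nat i) ltac:(lia).
have hdiv x : Z.div (Z.mul i (Z.of_nat x)) (Z.of_nat n)
               = Z.of_nat ((Z.to_nat i * x) %/ n).
  have := divn_eq (Z.to_nat i * x) n; have := ltn_pmod (Z.to_nat i * x) n0.
  move: (_ %% n) (_ %/ n) => r q; clear -hi n0 => rn e; symmetry.
  by apply: (Z.div_unique_pos _ _ _ (Z.of_nat r)); [lia | nia].
rewrite !hdiv.
move: {hr compl sum2 hdiv} hs (divn_eq (Z.to_nat i * x1) n) (divn_eq (Z.to_nat i * x2) n)
      (divn_eq (Z.to_nat i * x3) n) (divn_eq (Z.to_nat i * x4) n).
do 4! [move: (_ %% n) (_ %/ n) => ? ?] => hs e1 e2 e3 e4.
nia.
Qed.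

End WeightSums.

Set Implicit Arguments.
Unset Strict Implicit.

(** * Dickson's lemma and Fourier-Motzkin elimination *)

(** Let [M] serve the first [n] coordinates. It also serves every [x] whose last coordinate reaches
    the maximum [B] over [M]; each of the finitely many slices below [B] gets its own list by
    induction. *)
Lemma dickson (T : eqType) (f : T -> nat -> nat) (n : nat) (X : T -> Prop) :
  exists M : seq T, (forall m, m \in M -> X m) /\
    forall x, X x -> exists2 m, m \in M & forall k, (k < n)%N -> (f m k <= f x k)%N.
Proof.
elim: n X => [|n IHn] X.
  have [[x Xx]|nX] := pselect (exists x, X x).
    exists [:: x]; split=> [m|y _]; first by rewrite inE => /eqP ->.
    by exists x => //; rewrite inE.
  by exists [::]; split=> // x Xx; case: nX; exists x.
have [M [MX hM]] := IHn X.
have /choice[N hN] c := IHn (fun x => X x /\ f x n = c).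
pose B := (\max_(m <- M) f m n)%N.
exists (M ++ flatten [seq N c | c <- iota 0 B]); split=> [m|x Xx].
  rewrite mem_cat => /orP[/MX//|/flattenP[s /mapP[c _ ->]] ms].
  by have [/(_ m ms)[]] := hN c.
have [xB|xB] := ltnP (f x n) B.
  have [NX /(_ x (conj Xx erefl))[m mN hm]] := hN (f x n).
  exists m; first rewrite mem_cat; first apply/orP; first right.
    by apply/flattenP; exists (N (f x n)) => //; apply/mapP; exists (f x n); rewrite ?mem_iota.
  move=> k; rewrite ltnS leq_eqVlt => /orP[/eqP->|]; last exact: hm.
  by have [_ ->] := NX m mN.
have [m mM hm] := hM x Xx; exists m; first by rewrite mem_cat mM.
move=> k; rewrite ltnS leq_eqVlt => /orP[/eqP->|]; last exact: hm.
by apply: leq_trans xB; apply: (@leq_bigmax_seq _ M xpredT (f ^~ n) m).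
Qed.

(** The value [t] is the largest lower bound, or the smallest upper bound if there are no lower
    ones, or 0 if there are neither. *)
Lemma exists_between (R : realFieldType) (I : finType) (P Q : pred I) (l u : I -> R) :
  (forall i k, P i -> Q k -> l i <= u k) ->
  exists t, (forall i, P i -> l i <= t) /\ (forall k, Q k -> t <= u k).
Proof.
move=> lu; case: (pickP P) => [i0 Pi0|P0].
  case: (arg_maxP l Pi0) => i Pi hi.
  by exists (l i); split=> // k; apply: lu.
case: (pickP Q) => [k0 Qk0|Q0].
  case: (arg_minP u Qk0) => k Qk hk.
  by exists (u k); split=> // i; rewrite P0.
by exists 0; split=> i; rewrite ?P0 ?Q0.
Qed.

(** The relations [lam] are chosen before [b], so one finite list decides feasibility for all
    right-hand sides, in particular for all shifts s. The induction eliminates coordinate 0. *)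
Lemma fourier_motzkin (R : realFieldType) (d : nat) (I : finType) (a : I -> 'I_d -> int) :
  exists (K : finType) (lam : K -> I -> nat),
    (forall k j, \sum_i (lam k i)%:Z * a i j = 0) /\
    forall b : I -> R, (forall k, \sum_i (lam k i)%:R * b i <= 0) ->
      exists x : 'I_d -> R, forall i, b i <= \sum_j (a i j)%:~R * x j.
Proof.
elim: d I a => [|d IHd] I a.
  exists I, (fun k i => (k == i) : nat); split=> [k []//|b hb].
  exists (fun _ => 0) => i; rewrite big_ord0; have := hb i.
  rewrite (bigD1 i) //= eqxx mul1r big1 ?addr0 // => k /negPf.
  by rewrite eq_sym => ->; rewrite mul0r.
pose pos i := 0 < a i ord0; pose neg i := a i ord0 < 0.
(* Row [(i, i)] keeps an inequality not involving [x_0]; row [(i, k)] cancels [x_0] between a lower and an upper bound. *)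
pose M (p : I * I) (i : I) : nat :=
  if (a p.1 ord0 == 0) && (a p.2 ord0 == 0) then ((i == p.1) && (p.1 == p.2) : nat)
  else if pos p.1 && neg p.2 then
    ((i == p.1) * `|a p.2 ord0| + (i == p.2) * `|a p.1 ord0|)%N
  else 0%N.
have Msum (V : pzRingType) (p : I * I) (f : I -> V) : \sum_i (M p i)%:R * f i =
  if (a p.1 ord0 == 0) && (a p.2 ord0 == 0) then (p.1 == p.2)%:R * f p.1
  else if pos p.1 && neg p.2 then `|a p.2 ord0|%N%:R * f p.1 + `|a p.1 ord0|%N%:R * f p.2
  else 0.
  have pick q c : \sum_i ((i == q) * c)%:R * f i = c%:R * f q.
    rewrite (bigD1 q) //= eqxx mul1n big1 ?addr0 // => i /negPf ->.
    by rewrite mul0n mul0r.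
  rewrite /M; case: ifP => _.
    by rewrite -(pick p.1 (p.1 == p.2)); apply: eq_bigr => i _; rewrite mulnb.
  case: ifP => _; last by rewrite big1 // => i _; rewrite mul0r.
  by rewrite -!pick -big_split; apply: eq_bigr => i _; rewrite natrD mulrDl.
pose a' p j := \sum_i (M p i)%:Z * a i (lift ord0 j).
have [K [lam [lam0 lamP]]] := IHd _ a'.
exists K, (fun k i => \sum_p lam k p * M p i)%N.
have exch (V : pzRingType) k (f : I -> V) :
    \sum_i (\sum_p lam k p * M p i)%:R * f i = \sum_p (lam k p)%:R * \sum_i (M p i)%:R * f i.
  under [RHS]eq_bigr do rewrite big_distrr.
  rewrite exchange_big; apply: eq_bigr => i _; rewrite natr_sum big_distrl /=.
  by apply: eq_bigr => p _; rewrite natrM -mulrA.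
split=> [k j|b hb].
  have -> : \sum_i (\sum_p lam k p * M p i)%N%:Z * a i j =
    \sum_i (\sum_p lam k p * M p i)%:R * a i j by apply: eq_bigr => i _; rewrite natz.
  rewrite exch; case: (unliftP ord0 j) => [j' ->|->]; last first.
    apply: big1 => p _; rewrite Msum; case: ifP => [/andP[/eqP -> _]|_].
      by rewrite !mulr0.
    case: ifP => [/andP[p1 p2]|_]; last by rewrite mulr0.
    rewrite !natz !abszE (gtr0_norm p1) (ltr0_norm p2) mulNr.
    by rewrite [a p.2 _ * _]mulrC addNr mulr0.
  rewrite -[RHS](lam0 k j'); apply: eq_bigr => p _; rewrite natz; congr (_ * _).
  by apply: eq_bigr => i _; rewrite natz.
have [k|x' hx'] := lamP (fun p => \sum_i (M p i)%:R * b i).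
  by rewrite -exch.
pose y i := \sum_j (a i (lift ord0 j))%:~R * x' j.
have hy p : \sum_i (M p i)%:R * b i <= \sum_i (M p i)%:R * y i.
  apply: le_trans (hx' p) _; rewrite le_eqVlt; apply/orP; left; apply/eqP.
  under [RHS]eq_bigr do rewrite big_distrr.
  rewrite exchange_big; apply: eq_bigr => j _.
  rewrite rmorph_sum big_distrl; apply: eq_bigr => i _ /=.
  by rewrite rmorphM /= mulrA.
(* The bound on x_0 imposed by row [i]: a lower one on [pos], an upper one on [neg]. *)
pose t i := (b i - y i) / (a i ord0)%:~R.
have [i k pi nk|x0 [hl hu]] := @exists_between _ I pos neg t t.
  have ai : 0 < (a i ord0)%:~R :> R by rewrite ltr0z.
  have ak : 0 < - (a k ord0)%:~R :> R by rewrite oppr_gt0 ltrz0.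
  have := hy (i, k); rewrite !Msum /= pi nk /=.
  have -> : (a i ord0 == 0) = false by apply/negbTE; rewrite gt_eqF.
  have absk : `|a k ord0|%N%:R = - (a k ord0)%:~R :> R.
    by rewrite natr_absz ltr0_norm // rmorphN.
  have absi : `|a i ord0|%N%:R = (a i ord0)%:~R :> R by rewrite natr_absz gtr0_norm.
  rewrite /= absk absi => h; rewrite /t ler_pdivrMr // mulrAC.
  rewrite -[(a k ord0)%:~R]opprK invrN mulrN -mulNr ler_pdivlMr //.
  lra.
exists (fun j => if unlift ord0 j is Some j' then x' j' else x0) => i.
rewrite big_ord_recl unlift_none.
under eq_bigr do rewrite liftK.
rewrite -/(y i) -lerBlDr.
have [n0|p0|z0] := ltgtP (a i ord0) 0.
- by have := hu i n0; rewrite /t ler_ndivlMr ?ltrz0 // mulrC.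
- by have := hl i p0; rewrite /t ler_pdivrMr ?ltr0z // mulrC.
- rewrite z0 mulr0z mul0r subr_le0; have := hy (i, i).
  by rewrite !Msum /= z0 !eqxx /= !mul1r.
Qed.

(** * Integer dependences and Caratheodory's theorem *)

Lemma int_linear_dependence (d m : nat) (f : 'I_m -> 'I_d -> int) : (d < m)%N ->
  exists nu : 'I_m -> int, (exists k, nu k != 0) /\ forall j, \sum_k nu k * f k j = 0.
Proof.
move=> dm; pose B : 'M[rat]_(m, d) := \matrix_(k, j) (f k j)%:~R.
have : kermx B != 0.
  rewrite kermx_eq0; apply/negP => /eqP rB.
  by have := rank_leq_col B; rewrite rB leqNgt dm.
case/matrix0Pn=> i [k0 nz]; pose v k : rat := kermx B i k.
(* A rational kernel vector multiplied by the product of all its denominators. *)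
pose nu k := numq (v k) * \prod_(k' | k' != k) denq (v k').
have nuE k : (nu k)%:~R = (\prod_k' denq (v k'))%:~R * v k :> rat.
  by rewrite (bigD1 k) //= /nu !intrM numqE; ring.
exists nu; split.
  exists k0; rewrite mulf_neq0 ?numq_eq0 //.
  by apply/prodf_neq0 => k _; apply: denq_neq0.
move=> j; apply: (@intr_inj rat); rewrite rmorph_sum /=.
have BE k : B k j = (f k j)%:~R by rewrite mxE.
have /matrixP/(_ i j) := mulmx_ker B; rewrite [LHS]mxE [RHS]mxE => vB.
rewrite -[RHS](mulr0 (\prod_k' denq (v k'))%:~R) -[in RHS]vB big_distrr /=.
by apply: eq_bigr => k _; rewrite BE intrM nuE mulrA.
Qed.

Lemma int_affine_dependence (d : nat) (I : finType) (a : I -> 'I_d -> int) (S : {set I}) :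
  (d.+1 < #|S|)%N ->
  exists mu : I -> int, [/\ forall i, i \notin S -> mu i = 0, \sum_i mu i = 0,
    forall j, \sum_i mu i * a i j = 0 & exists i, 0 < mu i].
Proof.
move=> dS.
(* An extra coordinate 1 turns linear dependence into affine dependence. *)
pose f (k : 'I_#|S|) (j : 'I_d.+1) : int :=
  if unlift ord0 j is Some j' then a (enum_val k) j' else 1.
have [nu [[k0 nz0] nuP]] := @int_linear_dependence _ _ f dS.
pose mu i := \sum_(k | enum_val k == i) nu k.
have muE (g : I -> int) : \sum_i mu i * g i = \sum_k nu k * g (enum_val k).
  rewrite (partition_big (fun k : 'I_#|S| => enum_val k) xpredT) //=.
  apply: eq_bigr => i _; rewrite big_distrl; apply: eq_bigr => k /eqP <- //.
have muS i : i \notin S -> mu i = 0.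
  move=> iS; rewrite /mu big_pred0 // => k; apply/negP => /eqP ki.
  by rewrite -ki enum_valP in iS.
have mu1 : \sum_i mu i = 0.
  rewrite -[RHS](nuP ord0) -[LHS](_ : \sum_i mu i * 1 = _); last first.
    by apply: eq_bigr => i _; rewrite mulr1.
  by rewrite muE; apply: eq_bigr => k _; rewrite /f unlift_none.
have mua j : \sum_i mu i * a i j = 0.
  rewrite -[RHS](nuP (lift ord0 j)) muE.
  by apply: eq_bigr => k _; rewrite /f liftK.
have mu0 : mu (enum_val k0) != 0.
  rewrite /mu (big_pred1 k0) // => k /=.
  by apply/eqP/eqP => [/enum_val_inj|->].
have [mu_gt0|mu_lt0|mu_eq0] := ltgtP 0 (mu (enum_val k0)).
- by exists mu; split=> //; exists (enum_val k0).
- exists (fun i => - mu i); split=> [i /muS ->||j|]; rewrite ?oppr0 //.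
  + by rewrite sumrN mu1 oppr0.
  + by under eq_bigr do rewrite mulNr; rewrite sumrN mua oppr0.
  + by exists (enum_val k0); rewrite oppr_gt0.
- by rewrite -mu_eq0 eqxx in mu0.
Qed.

(** While the support is too large, a multiple of an affine dependence [mu] is subtracted.
    Minimality of lam / mu at [i0] keeps weights nonnegative and kills [i0]; since [mu] sums to 0,
    the total weight stays positive. *)
Lemma caratheodory (d : nat) (I : finType) (a : I -> 'I_d -> int) (lam : I -> nat) :
  (forall j, \sum_i (lam i)%:Z * a i j = 0) -> (exists i, (0 < lam i)%N) ->
  exists lam' : I -> nat,
    [/\ forall j, \sum_i (lam' i)%:Z * a i j = 0, exists i, (0 < lam' i)%N,
        forall i, (0 < lam' i)%N -> (0 < lam i)%N
      & (#|[set i | (0 < lam' i)%N]%SET| <= d.+1)%N].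
Proof.
have [s] := ubnP #|[set i | (0 < lam i)%N]%SET|.
elim: s lam => // s IHs lam; rewrite ltnS => lams lam0 [i1 lami1].
set S := [set i | _]%SET in lams.
have [small|big] := leqP #|S| d.+1.
  by exists lam; split=> //; exists i1.
have [mu [muS mu1 mua [i2 mui2]]] := @int_affine_dependence d I a S big.
have := @arg_minP _ _ _ i2 (fun i => 0 < mu i) (fun i => (lam i)%:R / (mu i)%:~R : rat) mui2.
case=> i0 mui0 min0.
pose w i : int := mu i0 * (lam i)%:Z - (lam i0)%:Z * mu i.
have w_ge0 i : 0 <= w i.
  rewrite subr_ge0; have [mi|mi] := ltP 0 (mu i); last by nia.
  have := min0 i mi; rewrite ler_pdivrMr ?ltr0z // mulrAC ler_pdivlMr ?ltr0z //.
  rewrite -[(lam i)%:R]/((lam i)%:Z%:~R) -[(lam i0)%:R]/((lam i0)%:Z%:~R) -!intrM ler_int.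
  by rewrite [X in _ <= X]mulrC.
have wE i : (`|w i|%N)%:Z = w i by rewrite abszE ger0_norm.
have w_supp i : (0 < `|w i|)%N -> (0 < lam i)%N.
  rewrite absz_gt0 !lt0n; apply: contra => /eqP lami.
  have iS : i \notin S by rewrite inE lami.
  by rewrite /w (muS i iS) lami !mulr0 subr0.
have lam_i0 : (0 < lam i0)%N.
  have : i0 \in S by apply: contraTT mui0 => /muS ->; rewrite ltxx.
  by rewrite inE.
have [||| lam' [h1 h2 h3 h4]] := IHs (fun i => `|w i|%N); last first.
- by exists lam'; split=> // i /h3 /w_supp.
- have : \sum_i w i != 0.
    rewrite /w big_split /= sumrN -!big_distrr /= mu1 mulr0 subr0 mulf_neq0 //.
      by rewrite gt_eqF.
    rewrite gt_eqF // (bigD1 i1) //=; apply: ltr_wpDr; last by lia.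
    by apply: sumr_ge0.
  apply: contraPP => none; apply/negP; rewrite negbK; apply/eqP; apply: big1 => i _.
  apply/eqP; rewrite -absz_eq0; apply/negPn/negP => wi; apply: none; exists i.
  by rewrite lt0n.
- move=> j; under eq_bigr do rewrite wE /w mulrBl -!mulrA.
  by rewrite big_split /= sumrN -!big_distrr /= lam0 mua !mulr0 subrr.
- apply: leq_trans lams; apply: proper_card; apply/properP; split.
    by apply/fintype.subsetP => i; rewrite !inE; apply: w_supp.
  by exists i0; rewrite !inE // /w mulrC subrr.
Qed.

Lemma caratheodory_ord (d : nat) (I : finType) (a : I -> 'I_d -> int) (lam : I -> nat) :
  (forall j, \sum_i (lam i)%:Z * a i j = 0) -> (exists i, (0 < lam i)%N) ->
  exists (g : 'I_d.+1 -> I) (w : 'I_d.+1 -> nat),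
    [/\ forall j, \sum_k (w k)%:Z * a (g k) j = 0, exists k, (0 < w k)%N
      & forall k, (0 < w k)%N -> (0 < lam (g k))%N].
Proof.
move=> h1 h2; have [lam' [{}h1 {h2}[i0 h2] h3 h4]] := @caratheodory d I a lam h1 h2.
set S := [set i | _]%SET in h4; pose e := enum S.
have se : (size e <= d.+1)%N by rewrite -cardE.
(* Slots beyond the support carry weight 0 and the default vector index [i0]. *)
exists (fun k => nth i0 e k), (fun k => if (k < size e)%N then lam' (nth i0 e k) else 0%N).
split=> [j||k]; last by case: ifP => // _; apply: h3.
  rewrite -[RHS](h1 j) (bigID [pred i | i \in S]) /= [X in _ = _ + X]big1 ?addr0; last first.
    by move=> i; rewrite inE lt0n negbK => /eqP ->; rewrite mul0r.
  rewrite -(big_enum _ _ S (fun i => (lam' i)%:Z * a i j)) /= -/e (big_nth i0) big_mkord.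
  pose F k := (lam' (nth i0 e k))%:Z * a (nth i0 e k) j.
  rewrite -[RHS]/(\sum_(k < size e) F k) (big_ord_widen _ F se).
  rewrite [RHS]big_mkcond; apply: eq_bigr => k _; case: ifP => // _; exact: mul0r.
have i0e : i0 \in e by rewrite mem_enum inE.
have lt : (index i0 e < size e)%N by rewrite index_mem.
by exists (Ordinal (leq_trans lt se)); rewrite /= lt nth_index.
Qed.

(** * Descent on the total weight of a relation *)

(** Vectors of weight 0 need not be active, so shorter relations fit the same index type. *)
Definition positive_relation (d : nat) (I : finType) (act : ('I_d -> int) -> Prop) (n : nat) :=
  exists (a : I -> 'I_d -> int) (lam : I -> nat),
    [/\ forall i, (0 < lam i)%N -> act (a i), (\sum_i lam i)%N = n
      & forall j, \sum_i (lam i)%:Z * a i j = 0].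

(** As [lam] sums to [n], the residues [r] sum to a multiple of [n], hence to 0 or [n]. If to 0, the
    quotients [m] form a relation of weight [j]. If to [n], then [b], minus the combination of the
    [a i] with weights [m], is a convex combination of the [a i]: either it is 0 and [m] has weight
    [j - 1], or it is active and replaces one vector. *)
Lemma positive_relation_descent (d : nat) (I : finType) (act : ('I_d -> int) -> Prop)
    (a : I -> 'I_d -> int) (lam : I -> nat) (n j : nat) :
  (forall (b : 'I_d -> int) (r : I -> nat), b <> (fun=> 0) ->
     (forall i, (0 < r i)%N -> act (a i)) -> (0 < \sum_i r i)%N ->
     (forall l, (\sum_i r i)%N%:Z * b l = \sum_i (r i)%:Z * a i l) -> act b) ->
  (forall i, (0 < lam i)%N -> act (a i)) -> (\sum_i lam i)%N = n ->
  (forall l, \sum_i (lam i)%:Z * a i l = 0) ->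
  (2 <= j < n)%N -> (\sum_i (j * lam i) %% n < 2 * n)%N ->
  exists2 n', (0 < n' < n)%N & positive_relation I act n'.
Proof.
move=> act_conv acta lamn lam0 /andP[j2 jn] rlt.
pose r i := ((j * lam i) %% n)%N; pose m i := ((j * lam i) %/ n)%N.
have n0 : (0 < n)%N by lia.
have mr i : (j * lam i = m i * n + r i)%N := divn_eq _ _.
have msupp i : (0 < m i)%N -> (0 < lam i)%N.
  by rewrite !lt0n; apply: contra => /eqP e; rewrite /m e muln0 div0n.
have rsupp i : (0 < r i)%N -> (0 < lam i)%N.
  by rewrite !lt0n; apply: contra => /eqP e; rewrite /r e muln0 mod0n.
have sum_mr : (j * n = (\sum_i m i) * n + \sum_i r i)%N.
  rewrite -[in LHS]lamn big_distrr big_distrl -big_split /=.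
  by apply: eq_bigr => i _; apply: mr.
have rel_mr l : n%:Z * \sum_i (m i)%:Z * a i l + \sum_i (r i)%:Z * a i l = 0.
  rewrite -[RHS](mulr0 j%:Z) -[in RHS](lam0 l) !big_distrr /= -big_split /=.
  apply: eq_bigr => i _; rewrite !mulrA -mulrDl; congr (_ * _).
  by rewrite -!PoszM -PoszD mr mulnC.
have mrel n' : (0 < n' < n)%N -> (\sum_i m i)%N = n' ->
    (forall l, \sum_i (m i)%:Z * a i l = 0) ->
    exists2 n', (0 < n' < n)%N & positive_relation I act n'.
  by move=> hn' hm m0; exists n' => //; exists a, m; split=> // i /msupp /acta.
have {}rlt : (\sum_i r i < 2 * n)%N by [].

have [q hq] : exists q, (\sum_i r i = q * n)%N.
  exists (j - \sum_i m i)%N; rewrite mulnBl; lia.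
have q2 : (q < 2)%N by rewrite hq in rlt; nia.
have {q2} [q0|q1] : q = 0%N \/ q = 1%N by lia.
  have r0 i : r i = 0%N.
    by apply/eqP; move: hq; rewrite q0 mul0n => /eqP; rewrite sum_nat_eq0 => /forallP /(_ i).
  apply: (mrel j); first by lia.
    by apply/eqP; rewrite -(eqn_pmul2r n0); apply/eqP; lia.
  move=> l; have := rel_mr l; rewrite [X in _ + X]big1 => [|i _]; last by rewrite r0 mul0r.
  by rewrite addr0 => /eqP; rewrite mulf_eq0 => /orP[/eqP|/eqP//]; lia.
rewrite q1 mul1n in hq.
have summ : (\sum_i m i = j.-1)%N.
  by apply/eqP; rewrite -(eqn_pmul2r n0); apply/eqP; nia.
pose b l := - \sum_i (m i)%:Z * a i l.
have [b0|bn0] := pselect (b = fun=> 0).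
  apply: (mrel j.-1) => //; first by lia.
  by move=> l; apply/eqP; rewrite -oppr_eq0; apply/eqP; apply: (congr1 (fun f => f l) b0).
have actb : act b.
  apply: (act_conv b r) => // [i /rsupp /acta //||l]; first by rewrite hq.
  by rewrite hq /b mulrN; apply/eqP; rewrite eq_sym -addr_eq0 addrC rel_mr.
have [i1 lami1] : exists i, (0 < lam i)%N.
  apply/existsP; rewrite -[X in is_true X]negbK negb_exists; apply/negP => /forallP h.
  by move: n0; rewrite -lamn big1 // => i _; have := h i; lia.
(* The relation b + sum_i m_i a_i = 0 has one vector too many; subtracting the multiple of the given relation that kills index i0 leaves total weight r i0 < n. *)
have := @arg_minP _ _ _ i1 (fun i => (0 < lam i)%N) (fun i => (m i)%:R / (lam i)%:R : rat) lami1.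
case=> i0 lami0 min0.
have mle i : (m i0 * lam i <= lam i0 * m i)%N.
  have [l0|l0] := posnP (lam i); first by rewrite l0 muln0.
  have := min0 i l0; rewrite ler_pdivrMr ?ltr0n // mulrAC ler_pdivlMr ?ltr0n //.
  by rewrite -!natrM ler_nat [X in (_ <= X)%N]mulnC.
pose w i := (lam i0 * m i - m i0 * lam i)%N.
have wi0 : w i0 = 0%N by rewrite /w mulnC subnn.
have wE i : (w i)%:Z = (lam i0)%:Z * (m i)%:Z - (m i0)%:Z * (lam i)%:Z.
  by rewrite /w; have := mle i; lia.
have sumw : (\sum_i w i)%N%:Z = (r i0)%:Z - (lam i0)%:Z.
  rewrite -[LHS]natz natr_sum (eq_bigr (fun i => (lam i0)%:Z * (m i)%:R - (m i0)%:Z * (lam i)%:R)).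
    rewrite big_split /= sumrN -!big_distrr /= -!natr_sum summ lamn.
    by have := mr i0; rewrite !natz; nia.
  by move=> i _; rewrite !natz wE.
(* By [sumw], r i0 >= lam i0 > 0. Slot [i0], emptied in [w], is reused for [b]. *)
exists (r i0); first by rewrite ltn_pmod // andbT; lia.
exists (fun i => if i == i0 then b else a i), (fun i => if i == i0 then lam i0 else w i).
split=> [i||l].
- case: eqP => // _ wi; apply: acta; move: wi; rewrite !lt0n; apply: contra => /eqP l0.
  by rewrite /w l0 /m l0 !muln0 div0n muln0.
- rewrite (bigD1 i0) //= eqxx (eq_bigr w); last by move=> i /negPf ->.
  by move: sumw; rewrite (bigD1 i0) //= wi0; lia.
rewrite (bigD1 i0) //= eqxx (eq_bigr (fun i => (w i)%:Z * a i l)); last by move=> i /negPf ->.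
have : \sum_i (w i)%:Z * a i l = \sum_(i | i != i0) (w i)%:Z * a i l.
  by rewrite (bigD1 i0) //= wi0 mul0r add0r.
move=> <-; under eq_bigr do rewrite wE mulrBl -!mulrA.
by rewrite big_split /= sumrN -!big_distrr /= lam0 mulr0 subr0 /b mulrN addNr.
Qed.

(** * Support functions and normals of lattice polytopes *)

Lemma dickson_ord (T : eqType) (n : nat) (f : T -> 'I_n -> nat) (X : T -> Prop) :
  exists M : seq T, (forall m, m \in M -> X m) /\
    forall x, X x -> exists2 m, m \in M & forall k, (f m k <= f x k)%N.
Proof.
have [M [MX hM]] := @dickson T (fun x k => oapp (f x) 0%N (insub k)) n X.
exists M; split=> // x /hM[m mM hm]; exists m => // k.
by have := hm k (ltn_ord k); rewrite valK.
Qed.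

Definition doti (d : nat) (a v : 'I_d -> int) : int := \sum_i a i * v i.

Section LatticePolytope.
Variables (R : realType) (d n : nat) (V : 'I_n -> 'I_d -> int).
Hypothesis fullV : full_dim R V.
Implicit Types (a b : 'I_d -> int) (x : 'I_d -> R) (s : R).

Local Notation P := (@conv_lat R d n V).

Lemma pair_ix_latpt a v : pair_ix a (latpt R v) = (doti a v)%:~R.
Proof. by rewrite /doti rmorph_sum; apply: eq_bigr => i _; rewrite /= intrM. Qed.

Lemma pair_ix_comb m (a : 'I_d -> int) (c : 'I_m -> R) (y : 'I_m -> 'I_d -> R) x :
  (forall j, x j = \sum_i c i * y i j) -> pair_ix a x = \sum_i c i * pair_ix a (y i).
Proof.
move=> xE; rewrite /pair_ix.
under eq_bigr => j _ do rewrite xE big_distrr.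
rewrite exchange_big; apply: eq_bigr => i _; rewrite big_distrr.
by apply: eq_bigr => j _ /=; rewrite mulrCA.
Qed.

Lemma n_gt0 : (0 < n)%N.
Proof.
have [c [c1 _]] := fullV (fun=> 0).
case: (posnP n) c c1 => // n0 c; rewrite big1 => [|i _].
  by move=> /esym/eqP; rewrite oner_eq0.
by have := ltn_ord i; rewrite [X in (_ < X)%N]n0.
Qed.

Definition minimizer a i := forall k, doti a (V i) <= doti a (V k).

Lemma minimizer_exists a : exists i, minimizer a i.
Proof.
have [i _ hi] := @arg_minP _ _ _ (Ordinal n_gt0) xpredT (fun i => doti a (V i)) isT.
by exists i => k; apply: hi.
Qed.

Lemma conv_lat_vertex i : P (latpt R (V i)).
Proof.
exists (fun k => (k == i)%:R); split; first by move=> k; apply: ler0n.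
split; first by rewrite (bigD1 i) //= eqxx big1 ?addr0 // => k /negPf ->.
move=> j; rewrite (bigD1 i) //= eqxx mul1r big1 ?addr0 // => k /negPf ->.
by rewrite mul0r.
Qed.

Lemma hP_minimizer a i : minimizer a i -> hP P a = (doti a (V i))%:~R.
Proof.
move=> mi; have lbP : lbound [set pair_ix a x | x in P] (doti a (V i))%:~R.
  move=> _ [x [w [w0 [w1 xE]]] <-]; rewrite (pair_ix_comb a xE).
  have -> : (doti a (V i))%:~R = \sum_k w k * (doti a (V i))%:~R.
    by rewrite -big_distrl /= w1 mul1r.
  apply: ler_sum => k _.
  by rewrite ler_wpM2l // pair_ix_latpt ler_int.
have inP : [set pair_ix a x | x in P] (doti a (V i))%:~R.
  by exists (latpt R (V i)); [apply: conv_lat_vertex | rewrite pair_ix_latpt].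
apply/eqP; rewrite eq_le; apply/andP; split.
  by apply: ge_inf inP; exists (doti a (V i))%:~R.
by apply: lb_le_inf lbP; exists (doti a (V i))%:~R.
Qed.

Lemma hP_le a i : hP P a <= (doti a (V i))%:~R.
Proof.
by have [k mk] := minimizer_exists a; rewrite (hP_minimizer mk) ler_int.
Qed.

Lemma hP_int a : exists z : int, hP P a = z%:~R.
Proof.
by have [k mk] := minimizer_exists a; exists (doti a (V k)); apply: hP_minimizer.
Qed.

(** Affine combinations of the points reach all of R^d, so a functional constant on them is constant
    everywhere, hence 0. *)
Lemma doti_nonconst a i : a <> (fun=> 0) -> exists k, doti a (V k) != doti a (V i).
Proof.
move=> a0; apply: contra_notP a0 => /forallNP h.
have {}h k : doti a (V k) = doti a (V i) by apply/eqP/negPn/negP; apply: h.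
have const x : pair_ix a x = (doti a (V i))%:~R.
  have [c [c1 xE]] := fullV x; rewrite (pair_ix_comb a xE).
  have -> : (doti a (V i))%:~R = \sum_k c k * (doti a (V i))%:~R.
    by rewrite -big_distrl /= c1 mul1r.
  by apply: eq_bigr => k _; rewrite pair_ix_latpt h.
have c0 : (doti a (V i))%:~R = 0 :> R.
  by rewrite -(const (fun=> 0)) /pair_ix big1 // => j _; rewrite mulr0.
apply/funext => j; apply: (@intr_inj R); rewrite mulr0z -[RHS]c0.
rewrite -(const (fun l => (l == j)%:R)) /pair_ix (bigD1 j) //= eqxx mulr1 big1 ?addr0 //.
by move=> l /negPf ->; rewrite mulr0.
Qed.

Lemma doti_sub a b i : doti (fun j => a j - b j) (V i) = doti a (V i) - doti b (V i).
Proof.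
by rewrite /doti -sumrB; apply: eq_bigr => j _; rewrite mulrBl.
Qed.

Lemma pair_ix_sub a b x : pair_ix (fun j => a j - b j) x = pair_ix a x - pair_ix b x.
Proof.
by rewrite /pair_ix -sumrB; apply: eq_bigr => j _; rewrite intrB mulrBl.
Qed.

(* On the normal cone of a vertex [a |-> <a, x> - hP a] is additive, so it only has to be tested on the finitely many elements of the cone that are minimal for the slacks [<a, V k> - hP a]. *)
Lemma finite_normals : exists H : seq ('I_d -> int),
  (forall a, a \in H -> a <> (fun=> 0)) /\
  forall s x, 0 <= s -> (forall a, a \in H -> hP P a + s <= pair_ix a x) ->
    forall a, a <> (fun=> 0) -> hP P a + s <= pair_ix a x.
Proof.
pose slack i a k := `|doti a (V k) - doti a (V i)|%N.
have /choice[M hM] i := @dickson_ord ('I_d -> int) n (slack i)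
  (fun a => a <> (fun=> 0) /\ minimizer a i).
exists (flatten [seq M i | i <- enum 'I_n]); split=> [a|s x s0 hx].
  by case/flattenP => _ /mapP[i _ ->] ai; have [/(_ a ai)[]] := hM i.
(* Induction on total slack: removing from [a] a Dickson-minimal [b] leaves a normal of the same
   cone with strictly less slack, as [b] is not constant on the points. *)
suff step i : forall m a, (\sum_k slack i a k < m)%N -> a <> (fun=> 0) -> minimizer a i ->
    hP P a + s <= pair_ix a x.
  by move=> a a0; have [i mi] := minimizer_exists a; apply: (step i _ _ (ltnSn _) a0 mi).
elim=> // m IHm a am a0 mi; have [MX /(_ a (conj a0 mi))[b bM ab]] := hM i.
have [b0 mb] := MX b bM.
have hb : hP P b + s <= pair_ix b x.
  by apply: hx; apply/flattenP; exists (M i) => //; apply: map_f; rewrite mem_enum.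
pose c j := a j - b j.
have [c0|c0] := pselect (c = fun=> 0).
  suff -> : a = b by [].
  by apply/funext => j; apply/eqP; rewrite -subr_eq0 -/(c j) c0.
have ck k : (slack i a k = slack i b k + slack i c k)%N /\ doti c (V i) <= doti c (V k).
  have := ab k; have := mi k; have := mb k; rewrite /slack /c !doti_sub; lia.
have mc : minimizer c i by move=> k; have [] := ck k.
have [k hk] := doti_nonconst i b0.
have := IHm c _ c0 mc; rewrite (hP_minimizer mc) (hP_minimizer mi) /c doti_sub pair_ix_sub.
move: hb; rewrite (hP_minimizer mb) intrB => hb hc.
(* Adding the inequalities for [b] and [c] yields 2s, of which one s >= 0 is dropped. *)
suff /hc : (\sum_k slack i c k < m)%N by lra.
move: am; rewrite (eq_bigr (fun k => slack i b k + slack i c k)%N); last first.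
  by move=> l _; have [] := ck l.
rewrite big_split /= (bigD1 k) //=.
have hs : (0 < slack i b k)%N by rewrite /slack absz_gt0 subr_eq0.
lia.
Qed.

Lemma fine_adjointP s x :
  fine_adjoint P s x <-> forall a, a <> (fun=> 0) -> hP P a + s <= pair_ix a x.
Proof.
by split=> h a; [move/eqP; apply: h | move=> /eqP; apply: h].
Qed.

(** By integrality a nonzero normal exceeds its minimum by at least 1 at some point of [V], hence by
    1 / n on average. This makes the optimal s positive. *)
Lemma fine_adjoint_barycenter :
  fine_adjoint P n%:R^-1 (fun j => \sum_k n%:R^-1 * latpt R (V k) j).
Proof.
have nR : 0 < n%:R :> R by rewrite ltr0n n_gt0.
apply/fine_adjointP => a a0; rewrite (@pair_ix_comb _ a (fun=> n%:R^-1) (fun k => latpt R (V k))) //.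
have [i mi] := minimizer_exists a; have [k hk] := doti_nonconst i a0.
rewrite -big_distrr /= mulrC ler_pdivlMr // mulrDl mulVf ?gt_eqF //.
under eq_bigr do rewrite pair_ix_latpt.
rewrite (hP_minimizer mi) mulr_natr -rmorph_sum /=.
have -> : (doti a (V i))%:~R *+ n + 1 = (doti a (V i) *+ n + 1)%:~R :> R.
  by rewrite intrD rmorphMn.
have -> : doti a (V i) *+ n = \sum_(l < n) doti a (V i) by rewrite sumr_const card_ord.
rewrite ler_int addrC -lerBrDr -sumrB (bigD1 k) //=.
rewrite -[1]addr0; apply: lerD; first by have := mi k; lia.
by apply: sumr_ge0 => l _; rewrite subr_ge0; apply: mi.
Qed.

End LatticePolytope.

(** * The optimal shift and its active normals *)

Section FineOptimum.
Variables (R : realType) (d n : nat) (V : 'I_n -> 'I_d -> int).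
Hypothesis fullV : full_dim R V.

Local Notation P := (@conv_lat R d n V).

(** Adding the inequalities for two opposite unit normals bounds 2s by the width of the polytope in
    that direction. *)
Lemma fine_adjoint_bounded (j0 : 'I_d) :
  exists B : R, forall s x, fine_adjoint P s x -> s <= B.
Proof.
pose e (z : int) := fun j : 'I_d => if j == j0 then z else 0.
have pe z (x : 'I_d -> R) : pair_ix (e z) x = z%:~R * x j0.
  rewrite /pair_ix (bigD1 j0) //= /e eqxx big1 ?addr0 // => j /negPf ->.
  by rewrite mul0r.
have e0 z : z != 0 -> e z <> (fun=> 0).
  by move=> z0 /(congr1 (fun f => f j0)); rewrite /e eqxx; apply/eqP.
exists (- (hP P (e 1) + hP P (e (-1))) / 2) => s x /fine_adjointP h.
have := h _ (e0 1 isT); have := h _ (e0 (-1) isT); rewrite !pe; lra.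
Qed.

Definition active (x : 'I_d -> R) (s : R) (a : 'I_d -> int) : Prop :=
  a <> (fun=> 0) /\ pair_ix a x = hP P a + s.

Definition fine_max (s : R) : Prop :=
  [/\ 0 < s, fine_adjoint P s !=set0
    & forall t, 0 < t -> fine_adjoint P t !=set0 -> t <= s].

Lemma fine_codegree_max s : fine_max s -> fine_codegree P = s^-1.
Proof.
move=> [s0 sP smax]; rewrite /fine_codegree; congr (_^-1).
have ub : ubound [set s | 0 < s /\ fine_adjoint P s !=set0] s.
  by move=> t [t0 tP]; apply: smax.
apply/eqP; rewrite eq_le; apply/andP; split.
  by apply: ge_sup ub; exists s.
by apply: ub_le_sup => //; exists s.
Qed.

Lemma pair_ix_linear (I : finType) (c : I -> R) (a : I -> 'I_d -> int) x :
  \sum_i c i * pair_ix (a i) x = \sum_j (\sum_i c i * (a i j)%:~R) * x j.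
Proof.
under eq_bigr => i _ do rewrite /pair_ix big_distrr.
rewrite exchange_big; apply: eq_bigr => j _; rewrite big_distrl.
by apply: eq_bigr => i _ /=; rewrite mulrA.
Qed.

Lemma natz_sum_intr (I : finType) (c : I -> nat) (a : I -> int) :
  \sum_i (c i)%:R * (a i)%:~R = (\sum_i (c i)%:Z * a i)%:~R :> R.
Proof. by rewrite rmorph_sum; apply: eq_bigr => i _; rewrite /= intrM. Qed.

(** Relation [k] demands c k + N k s <= 0, so the optimum is the least - c k / N k. For the
    minimizing [k] equality holds, so nonnegative slacks sum to 0 and every normal of positive
    weight is active. *)
Lemma fine_optimum (j0 : 'I_d) : exists s x,
  [/\ fine_max s, fine_adjoint P s x
    & exists2 N, (0 < N)%N & positive_relation 'I_d.+1 (active x s) N].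
Proof.
have [H [H0 HP]] := finite_normals fullV.
pose a (i : 'I_(size H)) : 'I_d -> int := nth (fun=> 0) H i.
have aH i : a i \in H by apply: mem_nth.
have [K [lam [lam0 lamP]]] := @fourier_motzkin R d _ a.
pose c k := \sum_i (lam k i)%:R * hP P (a i).
pose N k := (\sum_i lam k i)%N.
have split_rhs k s : \sum_i (lam k i)%:R * (hP P (a i) + s) = c k + (N k)%:R * s.
  rewrite /c /N natr_sum big_distrl -big_split /=.
  by apply: eq_bigr => i _; rewrite mulrDr.
have feasible s : 0 <= s -> (forall k, (0 < N k)%N -> c k + (N k)%:R * s <= 0) ->
    fine_adjoint P s !=set0.
  move=> s0 h; have [k|x hx] := lamP (fun i => hP P (a i) + s).
    have [Nk|] := posnP (N k); last by rewrite split_rhs; apply: h.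
    rewrite big1 // => i _.
    move/eqP: Nk; rewrite sum_nat_eq0 => /forallP /(_ i) /eqP ->; exact: mul0r.
  exists x; apply/fine_adjointP => b; apply: HP => // b' /(nthP (fun=> 0)) [m mH <-].
  exact: (hx (Ordinal mH)).
have relx (x : 'I_d -> R) k : \sum_i (lam k i)%:R * pair_ix (a i) x = 0.
  by rewrite pair_ix_linear big1 // => j _; rewrite natz_sum_intr lam0 mul0r.
have necessary s (x : 'I_d -> R) k : fine_adjoint P s x -> c k + (N k)%:R * s <= 0.
  move/fine_adjointP => h; rewrite -split_rhs -[leRHS](relx x k).
  by apply: ler_sum => i _; rewrite ler_wpM2l //; apply/h/H0.
(* Without such a relation every s >= 0 would be feasible, even |B| + 1. *)
have [k0 Nk0] : exists k, (0 < N k)%N.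
  apply: contrapT => /forallNP none; have [B hB] := fine_adjoint_bounded j0.
  have [|k /none//|x /hB] := feasible (`|B| + 1); first by rewrite addr_ge0.
  by rewrite leNgt ltr_pwDr // ler_norm.
have := @arg_minP _ _ _ k0 (fun k => (0 < N k)%N) (fun k => - c k / (N k)%:R) Nk0.
case=> k Nk kmin; set s := - c k / (N k)%:R in kmin.
have NR l : (0 < N l)%N -> 0 < (N l)%:R :> R by rewrite ltr0n.
have maxs t : fine_adjoint P t !=set0 -> t <= s.
  move=> [y hy]; have := necessary _ _ k hy; rewrite /s ler_pdivlMr ?NR // mulrC; lra.
have s0 : 0 < s.
  apply: lt_le_trans (maxs n%:R^-1 _); first by rewrite invr_gt0 ltr0n (n_gt0 fullV).
  by eexists; apply: fine_adjoint_barycenter.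
have [x hx] : fine_adjoint P s !=set0.
  apply: feasible; first exact: ltW.
  move=> l Nl; have := kmin l Nl; rewrite ler_pdivlMr ?NR // mulrC; lra.
exists s, x; split; [by split=> [||t _ /maxs]; [|exists x|] | exact: hx | ].
have tight i : (0 < lam k i)%N -> active x s (a i).
  move=> li; split; first exact/H0.
  have sum0 : \sum_i (lam k i)%:R * (pair_ix (a i) x - (hP P (a i) + s)) = 0.
    under eq_bigr do rewrite mulrBr.
    by rewrite sumrB relx split_rhs /s mulrCA mulfV ?gt_eqF ?NR //; ring.
  have term_ge0 l : 0 <= (lam k l)%:R * (pair_ix (a l) x - (hP P (a l) + s)).
    by rewrite mulr_ge0 // subr_ge0; move/fine_adjointP: hx; apply; apply: H0.
  have /eqP := psumr_eq0P (fun l _ => term_ge0 l) sum0 (isT : xpredT i).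
  by rewrite mulf_eq0 pnatr_eq0 -leqn0 leqNgt li /= subr_eq0 => /eqP.
have [||g [w [h1 [m wm] h3]]] := @caratheodory_ord d _ a (lam k).
- exact: lam0.
- apply: contrapT => /forallNP none; move: Nk; rewrite /N big1 // => i _.
  by have := none i; case: (lam k i) => // p /(_ isT).
exists (\sum_i w i)%N; first by rewrite (bigD1 m) //=; lia.
by exists (fun i => a (g i)), w; split=> // i /h3 /tight.
Qed.

(* [hP] is superadditive, so a lattice point of the convex hull of active normals satisfies [<b, x> <= hP b + s]. *)
Lemma active_conv (I : finType) (x : 'I_d -> R) s (a : I -> 'I_d -> int)
    (b : 'I_d -> int) (r : I -> nat) :
  fine_adjoint P s x -> b <> (fun=> 0) ->
  (forall i, (0 < r i)%N -> active x s (a i)) -> (0 < \sum_i r i)%N ->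
  (forall l, (\sum_i r i)%N%:Z * b l = \sum_i (r i)%:Z * a i l) -> active x s b.
Proof.
move=> /fine_adjointP hx b0 acta r0 bE; split=> //; apply/eqP.
rewrite eq_le hx // andbT; have [k mk] := minimizer_exists fullV b.
have rR : 0 < (\sum_i r i)%N%:R :> R by rewrite ltr0n.
have bx (y : 'I_d -> R) :
    (\sum_i r i)%N%:R * pair_ix b y = \sum_i (r i)%:R * pair_ix (a i) y.
  rewrite pair_ix_linear /pair_ix big_distrr; apply: eq_bigr => j _ /=.
  by rewrite natz_sum_intr -bE intrM mulrA.
rewrite -(ler_pM2l rR) bx mulrDr (hP_minimizer R mk) -pair_ix_latpt bx natr_sum big_distrl -big_split /=.
apply: ler_sum => i _; rewrite -mulrDr.
have [->|ri] := posnP (r i); first by rewrite !mul0r.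
have [_ ->] := acta i ri; rewrite ler_wpM2l // lerD2r pair_ix_latpt.
exact: hP_le.
Qed.

End FineOptimum.

(** * Denominators of the optimal shift in dimension three *)

Lemma fine_max_denominator (R : realType) (n : nat) (V : 'I_n -> 'I_3 -> int) :
  full_dim R V -> exists (s : R) (N m : nat),
    [/\ fine_max V s, N \in fine_primes, (0 < m)%N & N%:R * s = m%:R].
Proof.
move=> fullV; have [s [x [smax sx relN]]] := fine_optimum fullV ord0.
pose rel N := `[< (0 < N)%N /\ positive_relation 'I_4 (active V x s) N >].
have : exists N, rel N by case: relN => N N0 hN; exists N; apply/asboolP.
move=> /ex_minnP[N /asboolP[N0 [a [lam [acta lamN lam0]]]] Nmin].
(* Total weight 1 would make a single active normal equal to 0. *)
have N2 : (2 <= N)%N.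
  rewrite ltn_neqAle N0 andbT; apply/eqP => N1.
  have [i li] : exists i, (0 < lam i)%N.
    apply: contrapT => /forallNP none; move: N0; rewrite -lamN big1 // => i _.
    by have := none i; case: (lam i) => // p /(_ isT).
  have lamE : forall k, k != i -> lam k = 0%N.
    move=> k ki; move: lamN; rewrite -N1 (bigD1 i) //= (bigD1 k) //=; lia.
  have li1 : lam i = 1%N.
    by move: lamN; rewrite -N1 (bigD1 i) //= big1 ?addn0.
  have [] := acta i li; case; apply/funext => j; rewrite -[RHS](lam0 j).
  rewrite (bigD1 i) //= li1 mul1r big1 ?addr0 // => k /lamE ->; exact: mul0r.
have four (F : 'I_4 -> nat) : (\sum_i F i = F (inord 0) + F (inord 1) + F (inord 2) + F (inord 3))%N.
  rewrite !big_ord_recr big_ord0 /= add0n.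
  by do ![congr addn]; congr F; apply: val_inj; rewrite /= inordK.
have NP : N \in fine_primes.
  apply: (weight_sum_fine_primes N (lam (inord 0)) (lam (inord 1)) (lam (inord 2)) (lam (inord 3))) => //.
    by rewrite -four.
  move=> j jN; rewrite -(four (fun i => (j * lam i) %% N)%N) leqNgt; apply/negP => lt.
  have [|N' /andP[N'0 N'N] relN'] := @positive_relation_descent 3 _ (active V x s) a lam N j _ acta lamN lam0 jN lt.
    by move=> b r; apply: active_conv.
  have /Nmin : rel N' by apply/asboolP.
  by rewrite leqNgt N'N.
have [s0 _ _] := smax.
have [z zE] : exists z : int, N%:R * s = z%:~R :> R.
  have /choice[h hE] := fun i => hP_int fullV (a i).
  exists (- \sum_i (lam i)%:Z * h i); rewrite rmorphN /= -natz_sum_intr -lamN natr_sum big_distrl /=.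
  have : \sum_i (lam i)%:R * pair_ix (a i) x = 0.
    by rewrite pair_ix_linear big1 // => j _; rewrite natz_sum_intr lam0 mul0r.
  move=> relx; apply/eqP; rewrite -subr_eq0 opprK -big_split /= -[X in _ == X]relx; apply/eqP.
  apply: eq_bigr => i _; have [->|/acta[_ ->]] := posnP (lam i); first by rewrite !mul0r addr0.
  by rewrite hE; ring.
have zpos : 0 < z by rewrite -(ltr0z R) -zE mulr_gt0 // ltr0n.
exists s, N, `|z|%N; split=> //; first by rewrite absz_gt0 gt_eqF.
by rewrite zE natr_absz gtr0_norm.
Qed.

(** * Dilations and the structure of the spectrum *)

Definition dilate (k : nat) (d n : nat) (V : 'I_n -> 'I_d -> int) : 'I_n -> 'I_d -> int :=
  fun i j => k%:Z * V i j.

Lemma full_dim_dilate (R : realType) (k d n : nat) (V : 'I_n -> 'I_d -> int) :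
  (0 < k)%N -> full_dim R V -> full_dim R (dilate k V).
Proof.
move=> k0 fullV x; have [c [c1 cE]] := fullV (fun j => x j / k%:R).
exists c; split=> // j; rewrite -[LHS](@divfK _ k%:R) ?pnatr_eq0 ?gtn_eqF // cE.
by rewrite big_distrl; apply: eq_bigr => i _; rewrite /latpt /= intrM; ring.
Qed.

(** Since h_{kP} = k h_P, scaling by [k] carries P^{F(s)} onto (kP)^{F(ks)}. *)
Lemma fine_max_dilate (R : realType) (k d n : nat) (V : 'I_n -> 'I_d -> int) (s : R) :
  (0 < k)%N -> full_dim R V -> fine_max V s -> fine_max (dilate k V) (k%:R * s).
Proof.
move=> k0 fullV [s0 [x hx] smax].
have kR : 0 < k%:R :> R by rewrite ltr0n.
have dotk a i : doti a (dilate k V i) = k%:Z * doti a (V i).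
  by rewrite /doti big_distrr; apply: eq_bigr => j _; rewrite /dilate /= mulrCA.
have hk a : hP (@conv_lat R d n (dilate k V)) a = k%:R * hP (@conv_lat R d n V) a.
  have [i mi] := minimizer_exists fullV a.
  have mki : minimizer (dilate k V) a i by move=> l; rewrite !dotk ler_wpM2l.
  by rewrite (hP_minimizer R mi) (hP_minimizer R mki) dotk intrM.
have pk a (y : 'I_d -> R) (c : R) : pair_ix a (fun j => c * y j) = c * pair_ix a y.
  by rewrite /pair_ix big_distrr; apply: eq_bigr => j _; rewrite /= mulrCA.
split; first by rewrite mulr_gt0.
  exists (fun j => k%:R * x j); apply/fine_adjointP => a a0.
  by rewrite hk pk -mulrDr ler_pM2l //; move/fine_adjointP: hx; apply.
move=> t t0 [y hy]; rewrite mulrC -ler_pdivrMr //; apply: smax; first by rewrite divr_gt0.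
exists (fun j => k%:R^-1 * y j); apply/fine_adjointP => a a0.
rewrite pk [leRHS]mulrC ler_pdivlMr // mulrDl divfK ?gt_eqF // mulrC -hk.
by move/fine_adjointP: hy; apply.
Qed.

(** Supplies one element of the spectrum, from which every S_q is shown nonempty. *)
Lemma full_dim_std_simplex (R : realType) (d : nat) :
  exists (n : nat) (V : 'I_n -> 'I_d -> int), full_dim R V.
Proof.
exists d.+1, (fun i j => (unlift ord0 i == Some j)%:Z) => x.
exists (fun i => if unlift ord0 i is Some j then x j else 1 - \sum_j x j); split.
  rewrite big_ord_recl unlift_none [X in _ + X](eq_bigr x) ?subrK // => j _.
  by rewrite liftK.
move=> j; rewrite big_ord_recl /latpt !unlift_none /= mulr0 add0r.
rewrite (bigD1 j) //= liftK eqxx mulr1 big1 ?addr0 // => l lj.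
by rewrite liftK (inj_eq Some_inj) (negPf lj) mulr0.
Qed.

Theorem mainTheorem8 (R : realType) :
  exists S : nat -> set nat,
    (forall q : nat, q \in fine_primes ->
       S q !=set0 /\ (forall l : nat, S q l -> (0 < l)%N)) /\
    @fine_spectrum R 3 =
      [set x : R | exists q l k : nat,
         [/\ q \in fine_primes, S q l, (0 < k)%N &
             x = q%:R / (k * l)%:R]].
Proof.
have prime_gt0 q : q \in fine_primes -> (0 < q)%N.
  by move: q; apply/allP.
have spectrumE (mu : R) : fine_spectrum 3 mu ->
    exists N m : nat, [/\ N \in fine_primes, (0 < m)%N & mu = N%:R / m%:R].
  move=> [n [V [fullV ->]]]; have [s [N [m [smax NP m0 e]]]] := fine_max_denominator fullV.
  exists N, m; split=> //; rewrite (fine_codegree_max smax) -e.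
  by rewrite invfM mulrA mulfV ?mul1r // pnatr_eq0 -lt0n prime_gt0.
have spectrum_div (mu : R) k : (0 < k)%N -> fine_spectrum 3 mu -> fine_spectrum 3 (mu / k%:R).
  move=> k0 [n [V [fullV ->]]]; have [s [_ [_ [smax _ _ _]]]] := fine_max_denominator fullV.
  exists n, (dilate k V); split; first exact: full_dim_dilate.
  by rewrite (fine_codegree_max smax) (fine_codegree_max (fine_max_dilate k0 fullV smax)) invfM mulrC.
have [n0 [V0 full0]] := full_dim_std_simplex R 3.
have spec0 : fine_spectrum 3 (fine_codegree (@conv_lat R 3 n0 V0)) by exists n0, V0.
have [q0 [m0 [q0P m0_gt0 mu0E]]] := spectrumE _ spec0.
(* The largest possible choice of S_q; closure of the spectrum under division by [k] gives one
   inclusion, and k = 1 the other. *)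
exists (fun q l => (0 < l)%N /\ @fine_spectrum R 3 (q%:R / l%:R)); split.
  move=> q qP; split; last by move=> l [].
  (* The value q / (q m0) = 1 / m0 is the known element q0 / m0 divided by q0. *)
  exists (q * m0)%N; split; first by rewrite muln_gt0 prime_gt0.
  have := spectrum_div _ q0 (prime_gt0 _ q0P) spec0; rewrite mu0E.
  congr fine_spectrum; rewrite natrM.
  by field; rewrite !pnatr_eq0 -!lt0n m0_gt0 !prime_gt0.
apply/seteqP; split=> mu.
  move=> hmu; have [N [m [NP m_gt0 e]]] := spectrumE _ hmu.
  by exists N, m, 1%N; rewrite mul1n -e; split=> //; split=> //; rewrite -e.
move=> [q [l [k [qP [l0 ql] k0 ->]]]].
have := spectrum_div _ k k0 ql; congr fine_spectrum.
by rewrite natrM; field; rewrite !pnatr_eq0 -!lt0n k0 l0.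
Qed.
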